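(* Let $k\geq 1$ be an integer. The non-negative integer solutions $(x,y,z)$ of the Diophantine equation $2^x+(2^k\cdot 5)^y=z^2$ are exactly: $(x,y,z)=(3,0,3)$ (for any $k\geq 1$), and, for each positive integer $n$, $(k,x,y,z)=(2n,\,2n+2,\,1,\,2^n+2^{n+1})$ and $(k,x,y,z)=(2n+2,\,2n-2,\,1,\,2^{n-1}+2^{n+2})$.
   Context: Here $n$ ranges over the positive integers $\mathbb{N}=\{1,2,3,\dots\}$. *)

(* Defs.v *)
From mathcomp Require Import all_boot.

(* Main.v *)
(** For [y > 0], squares modulo 5 force [x] to be even. If [x = k * y], then
    [2 ^ x * (1 + 5 ^ y)] has odd 2-adic valuation. Otherwise, cancelling the
    smaller of the two powers of 2 leaves a factorization of [5 ^ y] or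
    [2 ^ b * 5 ^ y] into two coprime factors, which reduces the equation to
    [5 ^ y = 2 ^ b + 1] or [5 ^ y + 1 = 2 ^ b]. Modulo 4 the latter has no
    solution with [y > 0]; the former only has [(y, b) = (1, 2)], since for
    [b >= 3] reduction modulo 8 makes [y] even, and then [5 ^ y./2 + 1] is a
    power of 2. *)

Require Import Defs.
From mathcomp Require Import all_boot.
From mathcomp Require Import zify.

Lemma modn4_exp5 y : 5 ^ y = 1 %[mod 4].
Proof. by rewrite -modnXm exp1n. Qed.

Lemma exp5_succ_eq_exp2 y b : 5 ^ y + 1 = 2 ^ b -> y = 0.
Proof.
move=> E; have M := modn4_exp5 y.
case: b E => [|[|b]]; last by rewrite !expnS; lia.
- by move=> E; have := expn_gt0 5 y; lia.
- by case: y M => // y _; rewrite expnS; have := expn_gt0 5 y; lia.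
Qed.

Lemma exp5_eq_exp2_succ y b : 5 ^ y = 2 ^ b + 1 -> y = 1 /\ b = 2.
Proof.
move=> E; have M := modn4_exp5 y.
case: b E => [|[|[|b]]] E; try by rewrite ?expn0 ?expn1 in E; lia.
  split=> //; apply/eqP; rewrite -(eqn_exp2l (m := 5)) //.
  by apply/eqP; rewrite E.
have y_even : ~~ odd y.
  apply/negP => y_odd; move: E; rewrite -(odd_double_half y) y_odd add1n expnS.
  have : 5 ^ (y./2).*2 = 1 %[mod 8] by rewrite -mul2n expnM -modnXm exp1n.
  by rewrite !expnS; lia.
have Ey : y = y./2 * 2 by rewrite muln2 even_halfK.
rewrite Ey expnM in E; set t := y./2 in E Ey.
(* Difference of squares: [2 ^ b.+3 = (5 ^ t - 1) * (5 ^ t + 1)], and a divisor of a power of 2 is a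
   power of 2. *)
have : 5 ^ t + 1 %| 2 ^ b.+3.
  apply/dvdnP; exists (5 ^ t - 1).
  by rewrite -subn_sqr E exp1n addnK.
case/(dvdn_pfactor _ _ (p := 2) isT) => j _ /exp5_succ_eq_exp2 t0.
by move: E; rewrite t0 /= exp1n; have := expn_gt0 2 b.+3; lia.
Qed.

(** The prime [p] is coprime to at least one of the two factors; Gauss's lemma then puts the whole
    of [p ^ e] in the other. *)
Lemma coprime_pfactor_dvdM p e m n : prime p -> coprime m n ->
  p ^ e %| m * n -> p ^ e %| m \/ p ^ e %| n.
Proof.
move=> p_pr co_mn; case: (boolP (p %| m)) => [p_m|p'm] pe_mn.
  left; rewrite -(@Gauss_dvdl _ _ n) //; apply: coprimeXl.
  exact: coprime_dvdl co_mn.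
right; rewrite -(@Gauss_dvdr _ m) //; apply: coprimeXl.
by rewrite prime_coprime.
Qed.

Lemma eq_of_dvd_of_mul_eq p q m n : 0 < p * q ->
  p %| m -> q %| n -> m * n = p * q -> m = p /\ n = q.
Proof.
move=> pq_gt0 /dvdnP[s ->] /dvdnP[t ->].
rewrite mulnACA -{2}(mul1n (p * q)) => /eqP; rewrite eqn_pmul2r // muln_eq1.
by move=> /andP[/eqP-> /eqP->]; rewrite !mul1n.
Qed.

(** Squares are 0, 1 or 4 modulo 5, while powers of 4 are 1 or 4, so odd powers of 2 are 2 or 3. *)
Lemma exp2_sqr_mod5 x z : 2 ^ x = z ^ 2 %[mod 5] -> ~~ odd x.
Proof.
move=> E; apply/negP => x_odd; move: E.
rewrite -(odd_double_half x) x_odd add1n expnS -mul2n expnM.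
have : z ^ 2 %% 5 \in [:: 0; 1; 4].
  rewrite -modnXm; have : z %% 5 < 5 by rewrite ltn_mod.
  by case: (z %% 5) => [|[|[|[|[|]]]]].
have : (2 ^ 2) ^ x./2 %% 5 \in [:: 1; 4].
  elim: x./2 => // n IH; rewrite expnS -modnMmr.
  by move: IH; rewrite !inE => /orP[] /eqP ->.
by rewrite !inE; lia.
Qed.

Lemma sqr_exp2_add_exp5 d y w : 0 < d ->
  2 ^ (2 * d) + 5 ^ y = w ^ 2 -> [/\ d = 1, y = 1 & w = 3].
Proof.
move=> d_gt0 E.
have w_gt : 2 ^ d < w.
  by rewrite -(ltn_exp2r _ _ (e := 2)) // -E -expnM mulnC; have := expn_gt0 5 y; lia.
have Ew : w = 2 ^ d + (w - 2 ^ d) by lia.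
(* Now [5 ^ y] factors as [(w - 2 ^ d) * (w + 2 ^ d)]; the factors are odd and differ by a power of
   2, hence coprime. *)
move: (w - 2 ^ d) Ew => u Ew.
have Euv : u * (u + 2 ^ d.+1) = 5 ^ y.
  by move: E; rewrite Ew (mulnC 2 d) expnM (expnS 2 d) -!mulnn; nia.
have co_uv : coprime u (u + 2 ^ d.+1).
  rewrite /coprime gcdnDl -/(coprime _ _); apply: coprimeXr; rewrite coprimen2.
  by have := oddX 5 y; rewrite -Euv oddM orbT => /andP[].
have u_gt0 : 0 < u by lia.
have := expn_gt0 2 d.+1; have := dvdnn (5 ^ y).
rewrite -{2}Euv => /(coprime_pfactor_dvdM _ y _ _ (isT : prime 5) co_uv).
(* The product of both factors cannot exceed the larger one unless the smaller is 1. *)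
have u1 : 5 ^ y %| u + 2 ^ d.+1 -> u = 1.
  by move=> /dvdn_leq; rewrite -Euv => /(_ ltac:(lia)); nia.
case=> [/(dvdn_leq u_gt0)|/u1 u_eq1] pos; first by rewrite -Euv in pos *; nia.
move: Euv; rewrite u_eq1 mul1n addnC => /esym /exp5_eq_exp2_succ [-> [d1]].
by rewrite Ew u_eq1 d1.
Qed.

Lemma sqr_succ_exp2_mul_exp5 a y w : 0 < a -> 0 < y ->
  1 + 2 ^ a * 5 ^ y = w ^ 2 -> [/\ a = 4, y = 1 & w = 9].
Proof.
case: a => // a _ y_gt0 E.
have w_odd : odd w by have := oddX w 2; rewrite -E oddD oddM oddX.
have Ew : w = 2 * w./2 + 1 by rewrite -{1}(odd_double_half w) w_odd; lia.
set v := w./2 in Ew.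
have Ev : 2 * (v * v.+1) = 2 ^ a * 5 ^ y by move: E; rewrite Ew !expnS; nia.
(* The original exponent of 2 is now [a.+1]. It is not 1, since [5 ^ y] is odd; so it is [b.+2]. *)
case: a E Ev => [|b] E Ev.
  by have := oddX 5 y; rewrite -[5 ^ y]mul1n -Ev oddM orbT.
have {}Ev : v * v.+1 = 2 ^ b * 5 ^ y by move: Ev; rewrite expnS; lia.
have p2 := expn_gt0 2 b; have p5 : 5 <= 5 ^ y by rewrite -{1}(expn1 5) leq_exp2l.
have v_gt0 : 0 < v by nia.
have co : coprime v v.+1 by rewrite coprimenS.
have d2 : 2 ^ b %| v * v.+1 by rewrite Ev dvdn_mulr.
have d5 : 5 ^ y %| v * v.+1 by rewrite Ev dvdn_mull.
have co25 : coprime (2 ^ b) (5 ^ y) by apply: coprimeXl; apply: coprimeXr.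
(* Each prime power divides one of the coprime numbers [v] and [v.+1]. If both divide the same one,
   so does the product [v * v.+1], forcing [v <= 1], too small for a multiple of 5. *)
case: (coprime_pfactor_dvdM _ _ _ _ (isT : prime 2) co d2) => h2;
case: (coprime_pfactor_dvdM _ _ _ _ (isT : prime 5) co d5) => h5.
- have : v * v.+1 %| v by rewrite Ev Gauss_dvd // h2.
  by move=> /(dvdn_leq v_gt0); rewrite -[leqRHS]muln1 leq_pmul2l // ltnNge v_gt0.
- have [v2 v5] : v = 2 ^ b /\ v.+1 = 5 ^ y.
    by apply: eq_of_dvd_of_mul_eq => //; rewrite muln_gt0 !expn_gt0.
  have /exp5_eq_exp2_succ[-> b2] : 5 ^ y = 2 ^ b + 1 by rewrite -v5 -v2 addn1.
  by rewrite Ew v2 b2.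
- have [v5 v2] : v = 5 ^ y /\ v.+1 = 2 ^ b.
    by apply: eq_of_dvd_of_mul_eq; rewrite // ?muln_gt0 ?expn_gt0 // Ev mulnC.
  have /exp5_succ_eq_exp2 : 5 ^ y + 1 = 2 ^ b by rewrite -v5 -v2 addn1.
  by lia.
- have : v * v.+1 %| v.+1 by rewrite Ev Gauss_dvd // h2.
  move=> /(dvdn_leq (ltn0Sn v)); rewrite -[leqRHS]mul1n leq_pmul2r // => v_le1.
  have v1 : v = 1 by lia.
  by have := leq_mul p2 p5; rewrite -Ev v1.
Qed.

(** Both [z - 1] and [z + 1] are powers of 2, and the only powers of 2 differing by 2 are 2 and
    4. *)
Lemma sqr_exp2_succ x z : 2 ^ x + 1 = z ^ 2 -> x = 3 /\ z = 3.
Proof.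
move=> E; have z_gt1 : 1 < z by have := expn_gt0 2 x; nia.
have F : 2 ^ x = (z - 1) * (z + 1) by nia.
have /(dvdn_pfactor _ _ (p := 2) isT)[i _ Ei] : z - 1 %| 2 ^ x.
  by rewrite F dvdn_mulr.
have /(dvdn_pfactor _ _ (p := 2) isT)[j _ Ej] : z + 1 %| 2 ^ x.
  by rewrite F dvdn_mull.
have z3 : z = 3.
  case: i Ei => [|[|i]] Ei; rewrite ?expn0 ?expn1 in Ei; last first.
  - by case: j Ej => [|[|j]]; rewrite ?expn0 ?expn1; move: Ei; rewrite ?expnS; lia.
  - by lia.
  - by have z2 : z = 2 by [lia]; move: Ej; rewrite z2; case: j => [|[|j]] //; rewrite !expnS; lia.
split=> //; apply/eqP; rewrite -(eqn_exp2l (m := 2)) //.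
by rewrite z3 in F; rewrite F.
Qed.

(* Truncated subtractions only occur under [1 <= n]. *)
Theorem theorem3p3 (k : nat) (hk : 1 <= k) (x y z : nat) :
  2 ^ x + (2 ^ k * 5) ^ y = z ^ 2 <->
    [\/ (x, y, z) = (3, 0, 3),
        exists2 n : nat, 1 <= n &
          (k, x, y, z) = (2 * n, 2 * n + 2, 1, 2 ^ n + 2 ^ (n + 1))
      | exists2 n : nat, 1 <= n &
          (k, x, y, z) =
            (2 * n + 2, 2 * n - 2, 1, 2 ^ (n - 1) + 2 ^ (n + 2))].
Proof.
split; last first.
  case=> [[-> -> ->] //|[n _ [-> -> -> ->]]|[[//|n] _ [-> -> -> ->]]].
    by rewrite expn1 (mulnC 2 n) !expnD expnM; nia.
  rewrite subn1 [2 * _ - 2](_ : _ = 2 * n); last lia.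
  by rewrite expn1 !(mulnC 2) !expnM !expnD expnM /= (expnS 2 n); nia.
case: y => [|y']; first by rewrite expn0 => /sqr_exp2_succ[-> ->]; constructor 1.
set y := y'.+1; have y_gt0 : 0 < y by [].
rewrite expnMn -expnM => E.
have x_even : ~~ odd x.
  apply: (@exp2_sqr_mod5 _ z).
  by rewrite -E [5 ^ y]expnS mulnCA -modnDmr modnMr addn0.
have {x_even}: x = 2 * x./2 by rewrite mul2n even_halfK.
move: x./2 => m Ex; rewrite {x}Ex in E *.
case: (ltngtP (2 * m) (k * y)) => [lt|gt|eq].
- have Eky : k * y = 2 * m + (k * y - 2 * m) by lia.
  have a_gt0 : 0 < k * y - 2 * m by lia.
  move: (k * y - 2 * m) a_gt0 Eky => a a_gt0 Eky.
  have /dvdnP[w Ew] : 2 ^ m %| z.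
    rewrite -(dvdn_pexp2r _ _ (k := 2)) // -E -expnM (mulnC m) Eky expnD.
    by rewrite -mulnA -{2}[2 ^ (2 * m)]muln1 -mulnDr dvdn_mulr.
  have /(sqr_succ_exp2_mul_exp5 _ _ _ a_gt0 y_gt0)[a4 y1 w9] :
      1 + 2 ^ a * 5 ^ y = w ^ 2.
    apply/eqP; rewrite -(eqn_pmul2l (m := 2 ^ (2 * m))) ?expn_gt0 //.
    by rewrite mulnDr muln1 mulnA -expnD -Eky E Ew expnMn -expnM mulnC (mulnC m).
  (* Here [k = 2 * m + 4] and [z = 9 * 2 ^ m], with [9 = 1 + 2 ^ 3]; so [n] is [m.+1]. *)
  constructor 3; exists m.+1 => //; rewrite y1 in Eky *.
  rewrite subn1 /= Ew w9; congr (_, _, _, _); try lia.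
  by rewrite addSn !expnS expnD; lia.
- have Ex : 2 * m = k * y + (2 * m - k * y) by lia.
  (* Factoring out [2 ^ (k * y)] leaves an odd cofactor, so [k * y] is the 2-adic valuation of a
     square. *)
  have ky_even : k * y = 2 * logn 2 z.
    rewrite -lognX -E Ex expnD -mulnDr lognM ?expn_gt0 //; last first.
      by rewrite addn_gt0 expn_gt0.
    rewrite pfactorK // logn_coprime ?addn0 // coprime2n oddD !oddX orbT.
    by rewrite subn_eq0 leqNgt gt.
  move: (logn 2 z) ky_even => e Eky; rewrite Eky in E Ex gt.
  have Em : m = e + (m - e) by lia.
  have d_gt0 : 0 < m - e by lia.
  move: (m - e) d_gt0 Em => d d_gt0 Em; rewrite Em mulnDr expnD in E.
  have /dvdnP[w Ew] : 2 ^ e %| z.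
    by rewrite -(dvdn_pexp2r _ _ (k := 2)) // -E -expnM (mulnC e) -mulnDr dvdn_mulr.
  have : 2 ^ (2 * d) + 5 ^ y = w ^ 2.
    apply/eqP; rewrite -(eqn_pmul2l (m := 2 ^ (2 * e))) ?expn_gt0 //.
    by rewrite mulnDr E Ew expnMn -expnM mulnC (mulnC e).
  move=> /(sqr_exp2_add_exp5 _ _ _ d_gt0)[d1 y1 w3].
  rewrite y1 in Eky *; constructor 2; exists e; first lia.
  rewrite Em d1 Ew w3; congr (_, _, _, _); try lia.
  by rewrite expnD; lia.
- have /eqP : 2 * logn 2 z = (2 * m).+1.
    have M := modn4_exp5 y.
    (* As [1 + 5 ^ y] is 2 modulo 4, its half is odd and it contributes exactly one factor 2. *)
    have Eh : 1 + 5 ^ y = 2 * ((1 + 5 ^ y) %/ 2) by lia.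
    rewrite -lognX -E -eq -{1}[2 ^ (2 * m)]muln1 -mulnDr Eh mulnA -expnSr.
    rewrite lognM ?expn_gt0 //; last by lia.
    by rewrite pfactorK // logn_coprime ?addn0 // coprime2n; lia.
  by lia.
Qed.
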